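(* Let $G$ be a group and $Q=\mathrm{Core}(G)$. The following are equivalent: (i) $Q$ is primitive. (ii) $Q$ is simple. (iii) $G$ is a simple group.
   Context: A quandle is a set $Q$ with a binary operation $*$ such that every left translation $L_x:y\mapsto x*y$ is bijective, $x*(y*z)=(x*y)*(x*z)$ and $x*x=x$ for all $x,y,z\in Q$. For a group $G$, $\mathrm{Core}(G)$ is the quandle with underlying set $G$ and operation $x*y=xy^{-1}x$. The left multiplication group is $\mathrm{LMlt}(Q)=\langle L_x : x\in Q\rangle\le\mathrm{Sym}(Q)$. A congruence of $Q$ is an equivalence relation compatible with $*$ and with the left division $x\backslash y=L_x^{-1}(y)$. A quandle $Q$ is simple if its congruence lattice has exactly two elements. A quandle $Q$ is primitive if the natural action of $\mathrm{LMlt}(Q)$ on $Q$ is primitive; here an action of a group on a set $X$ with more than one element is called primitive if the only invariant equivalence relations on $X$ are the identity relation and the full relation $X\times X$. Simple groups are nontrivial. *)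

(* Defs.v *)
From Corelib Require RelationClasses.
From HB Require Import structures.
From mathcomp Require Import all_boot.
From mathcomp Require Import boolp classical_sets.

Set Implicit Arguments.
Unset Strict Implicit.
Unset Printing Implicit Defensive.

Local Open Scope classical_set_scope.
Local Open Scope group_scope.

HB.mixin Record isQuandle Q := {
  qop : Q -> Q -> Q;
  qop_bij : forall x : Q, bijective (qop x);
  qopA : forall x y z : Q, qop x (qop y z) = qop (qop x y) (qop x z);
  qopxx : forall x : Q, qop x x = x
}.

#[short(type="quandleType")]
HB.structure Definition Quandle := {Q of isQuandle Q}.

Section QuandleDefs.
Variable Q : quandleType.
Implicit Types x y : Q.

Lemma qop_surj x y : exists z, qop x z = y.
Proof. by case: (qop_bij x) => g _ gK; exists (g y). Qed.

(* [qldiv x] is the inverse of the bijection [qop x]; see [qopK], [qldivK]. *)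
Definition qldiv x y : Q := projT1 (cid (qop_surj x y)).

Lemma qldivK x : cancel (qldiv x) (qop x).
Proof. by move=> y; rewrite /qldiv; case: cid. Qed.

Lemma qopK x : cancel (qop x) (qldiv x).
Proof. by move=> y; apply: (bij_inj (qop_bij x)); rewrite qldivK. Qed.

End QuandleDefs.

(* Subgroups of Sym(X), as sets of functions X -> X. As the members are
   bijective, [cancel f g] says that g is the two-sided inverse of f. *)
Definition perm_subgroup (X : Type) (H : set (X -> X)) : Prop :=
  [/\ H `<=` [set f | bijective f],
      H id,
      forall f g, H f -> H g -> H (f \o g)
    & forall f g, H f -> cancel f g -> H g].

Definition LMlt (Q : quandleType) : set (Q -> Q) :=
  smallest (@perm_subgroup Q) (range (@qop Q)).

Arguments LMlt : clear implicits.

Definition primitive_action (X : Type) (H : set (X -> X)) : Prop :=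
  (exists x y : X, x <> y) /\
  forall E : X -> X -> Prop,
    RelationClasses.Equivalence E ->
    (forall f, H f -> forall x y, E x y -> E (f x) (f y)) ->
    E = (fun x y => x = y) \/ E = (fun _ _ => True).

Definition primitive_quandle (Q : quandleType) : Prop :=
  primitive_action (LMlt Q).

Definition congruences (Q : quandleType) : set (Q -> Q -> Prop) :=
  [set E | [/\ RelationClasses.Equivalence E,
      forall x x' y y', E x x' -> E y y' -> E (qop x y) (qop x' y')
    & forall x x' y y', E x x' -> E y y' -> E (qldiv x y) (qldiv x' y')]].

Arguments congruences : clear implicits.

Definition simple_quandle (Q : quandleType) : Prop :=
  exists E1 E2 : Q -> Q -> Prop,
    E1 <> E2 /\ congruences Q = [set E1; E2].

Definition normal_subgroup (G : groupType) (N : set G) : Prop :=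
  [/\ N 1,
      forall x y, N x -> N y -> N (x * y),
      forall x, N x -> N x^-1
    & forall x g, N x -> N (x ^ g)].

(* The library's [simple] is only about finite groups. *)
Definition simple_group (G : groupType) : Prop :=
  (exists x : G, x <> 1) /\
  forall N : set G, normal_subgroup N -> N = [set 1] \/ N = [set: G].

Definition core (G : Type) : Type := G.

Section Core.
Variable G : groupType.

Definition core_op (x y : core G) : core G := (x : G) * (y : G)^-1 * (x : G).

Lemma core_opK x : involutive (core_op x).
Proof. by move=> y; rewrite /core_op !invgM invgK !mulgA mulgV mul1g mulgVK. Qed.

Lemma core_op_bij x : bijective (core_op x).
Proof. by exists (core_op x); apply: core_opK. Qed.

Lemma core_opA x y z :
  core_op x (core_op y z) = core_op (core_op x y) (core_op x z).
Proof. by rewrite /core_op !invgM !invgK !mulgA mulgK !mulgVK. Qed.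

Lemma core_opxx x : core_op x x = x.
Proof. by rewrite /core_op mulgV mul1g. Qed.

HB.instance Definition _ :=
  isQuandle.Build (core G) core_op_bij core_opA core_opxx.

End Core.

(* Main.v *)
Require Import Defs.
From mathcomp Require Import all_boot.
From mathcomp Require Import boolp classical_sets.

(** For (iii) => (i), let [E] be an equivalence invariant under the maps
    [y |-> x y^-1 x], hence under [y |-> z y z].  If [a b c = 1], composing the
    latter maps for [c], [b], [a] gives the right translation by [c b a], so
    the elements whose right translation preserves [E] form a normal subgroup
    [T] containing all commutators.  If [T = G], then [E] is invariant under all
    translations on both sides, and the class of [1] is a normal subgroup
    determining [E].  If [T = 1], then [G] is abelian and [y |-> z y z] is the
    translation by [z^2], so [z^2 = 1] for all [z] and [G] has two elements. *)

Local Open Scope classical_set_scope.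
Local Open Scope group_scope.

Lemma qop_LMlt {Q : quandleType} (x : Q) : LMlt Q (qop x).
Proof. by move=> H [_ sub]; apply: sub; exists x. Qed.

(** The bijections that preserve and reflect [E] form a subgroup of Sym(Q). It contains the left
    translations: compatibility with [qop] preserves [E], compatibility with [qldiv] reflects it. *)
Lemma congruence_LMlt {Q : quandleType} {E : Q -> Q -> Prop} {f : Q -> Q} :
  congruences Q E -> LMlt Q f -> forall x y, E x y -> E (f x) (f y).
Proof.
move=> [[Er _ _] Eop Ediv] Hf.
pose H := [set g : Q -> Q | bijective g /\
                            forall x y, E x y <-> E (g x) (g y)].
suff [_ Ef] : H f by move=> x y /Ef.
apply: Hf; split=> [|_ [x _ <-]]; last first.
  split=> [|y z]; first exact: qop_bij.
  split=> [|/(Ediv _ _ _ _ (Er x))]; first exact: Eop (Er x).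
  by rewrite !qopK.
split=> [g [] //||g h [bg Eg] [bh Eh]|g h [bg Eg] gh].
- by split=> //; exists id.
- split=> [|x y /=]; first exact: bij_comp.
  by rewrite -Eg -Eh.
- have hg : cancel h g by apply/(bij_can_sym bg).
  by split=> [|x y]; [exists g | rewrite [X in _ <-> X]Eg !hg].
Qed.

Lemma congruence_eq (Q : quandleType) : congruences Q (fun x y => x = y).
Proof. by split=> [|x _ y _ <- <-|x _ y _ <- <-] //; split=> // x y z ->. Qed.

Lemma congruence_full (Q : quandleType) : congruences Q (fun _ _ => True).
Proof. by []. Qed.

Lemma eq_neq_full {X : Type} {x y : X} :
  x <> y -> (fun a b : X => a = b) <> (fun _ _ => True).
Proof. by move=> xy /(congr1 (fun E => E x y)) e; apply: xy; rewrite e. Qed.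

Lemma primitive_simple_quandle {Q : quandleType} :
  primitive_quandle Q -> simple_quandle Q.
Proof.
move=> [[x [y xy]] prim].
exists (fun a b => a = b), (fun _ _ => True); split; first exact: eq_neq_full xy.
apply/seteqP; split=> [E cE|E [] ->]; last exact: congruence_full.
- by apply: prim => [|f Hf]; [case: cE | exact: congruence_LMlt].
- exact: congruence_eq.
Qed.

(** On a one-point set all reflexive relations coincide, so there cannot be two congruences. *)
Lemma simple_quandle_nontrivial {Q : quandleType} :
  simple_quandle Q -> forall x : Q, exists y, y <> x.
Proof.
move=> [E1 [E2 [E12 defC]]] x; apply: contrapT => /forallNP allx.
have eqx y : y = x by apply: contrapT; apply: allx.
have [[r1 _ _] _ _] : congruences Q E1 by rewrite defC; left.
have [[r2 _ _] _ _] : congruences Q E2 by rewrite defC; right.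
apply: E12; apply/funext => y; apply/funext => z; apply/propext.
by rewrite (eqx y) (eqx z).
Qed.

(** Equality and the full relation are distinct congruences once [Q] has two points, so they exhaust
    the pair [E1], [E2]. *)
Lemma simple_quandle_congruence {Q : quandleType} {E : Q -> Q -> Prop} :
  simple_quandle Q -> congruences Q E ->
  E = (fun x y => x = y) \/ E = (fun _ _ => True).
Proof.
move=> sQ cE; have [E1 [E2 [_ defC]]] := sQ.
case: (pselect (exists x : Q, True)) => [[x _]|noQ]; last first.
  by left; apply/funext => x; case: noQ; exists x.
have [y yx] := simple_quandle_nontrivial sQ x.
have := eq_neq_full yx; move: cE (congruence_eq Q) (congruence_full Q).
by rewrite defC => -[] -> [] -> [] ->; auto.
Qed.

Section Core.
Context {G : groupType}.
Implicit Types (x y z : G) (N : set G).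

Lemma qop_coreE x y : qop (x : core G) y = x * y^-1 * x.
Proof. by []. Qed.

Lemma qldiv_coreE x y : qldiv (x : core G) y = x * y^-1 * x.
Proof. by apply: (bij_inj (qop_bij (x : core G))); rewrite qldivK [RHS]core_opK. Qed.

Lemma normal_subgroup_congruence {N} :
  normal_subgroup N -> congruences (core G) (fun x y : G => N (x^-1 * y)).
Proof.
move=> [N1 NM NV NJ].
have Nop x x' y y' : N (x^-1 * x') -> N (y^-1 * y') ->
    N ((x * y^-1 * x)^-1 * (x' * y'^-1 * x')).
  move=> Nx Ny.
  (* This writes the quotient as a product of conjugates of elements of [N]. *)
  have -> : (x * y^-1 * x)^-1 * (x' * y'^-1 * x') =
      (x^-1 * x') ^ (y^-1 * x) * (y^-1 * y')^-1 ^ (y^-1 * x) * (x^-1 * x').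
    by rewrite /conjg !invgM !invgK !mulgA !(mulgVK, mulgK).
  by apply: (NM _ _ _ Nx); apply: NM; apply: NJ => //; apply: NV.
split=> //.
- split=> [x|x y /NV|x y z Nxy Nyz].
  + by rewrite mulVg.
  + by rewrite invgM invgK.
  + by have := NM _ _ Nxy Nyz; rewrite mulgA mulgK.
(* Left translations of the core are involutions, so left division is the operation itself. *)
- by move=> x x' y y'; rewrite !qldiv_coreE; exact: Nop.
Qed.

(** A normal subgroup is the class of 1 in its congruence. *)
Lemma simple_quandle_core_group : simple_quandle (core G) -> simple_group G.
Proof.
move=> sQ; split; first exact: simple_quandle_nontrivial sQ (1 : G).
move=> N nN; have [N1 _ _ _] := nN.
case: (simple_quandle_congruence sQ (normal_subgroup_congruence nN)) => eqE.
- left; apply/seteqP; split=> [x Nx|_ -> //].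
  have /= := congr1 (fun E => E 1 x) eqE.
  by rewrite invg1 mul1g => e; move: Nx; rewrite e.
- right; apply/seteqP; split=> // x _.
  by have /= := congr1 (fun E => E 1 x) eqE; rewrite invg1 mul1g => ->.
Qed.

Section Invariant.
Context {E : G -> G -> Prop}.
Hypothesis eqvE : RelationClasses.Equivalence E.
Hypothesis invE : forall z x y, E x y -> E (z * x * z) (z * y * z).

Let Erefl x : E x x. Proof. by case: eqvE. Qed.
Let Esym x y : E x y -> E y x. Proof. by case: eqvE => _ s _; exact: s. Qed.
Let Etrans x y z : E x y -> E y z -> E x z.
Proof. by case: eqvE => _ _ t; exact: t. Qed.

(** The equivalence, rather than an implication, gives closure under inverses. *)
Definition rtrans_stab : set G := [set c | forall x y, E x y <-> E (x * c) (y * c)].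

Lemma two_sided_iff z x y : E x y <-> E (z * x * z) (z * y * z).
Proof.
split=> [|/(invE z^-1)]; first exact: invE.
by rewrite !mulgA mulVg !mul1g !mulgK.
Qed.

Lemma rtrans_stab_normal : normal_subgroup rtrans_stab.
Proof.
split=> [x y|c d Tc Td x y|c Tc x y|c g Tc x y].
- by rewrite !mulg1.
- by rewrite !mulgA -Td -Tc.
- by rewrite [X in _ <-> X]Tc !mulgVK.
(* Right translation by [c ^ g] is the two-sided map for [g^-1], then right translation by [c], then
   the two-sided map for [g]. *)
- by rewrite (two_sided_iff g^-1) Tc (two_sided_iff g) /conjg !mulgA mulgV !mul1g.
Qed.

Lemma rtrans_stab_rev a b c : a * b * c = 1 -> rtrans_stab (c * b * a).
Proof.
move=> abc x y.
rewrite (two_sided_iff c) (two_sided_iff b) (two_sided_iff a).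
by rewrite !mulgA abc !mul1g.
Qed.

Lemma rtrans_stab_full :
  simple_group G -> rtrans_stab = [set: G] ->
  E = (fun x y => x = y) \/ E = (fun _ _ => True).
Proof.
move=> [_ sG] TG.
have Er c x y : E x y -> E (x * c) (y * c).
  by have : rtrans_stab c; [rewrite TG | move=> Tc /Tc].
have El c x y : E x y -> E (c * x) (c * y).
  by move=> /(invE c) /(Er c^-1); rewrite !mulgK.
have nN : normal_subgroup [set x | E 1 x].
  split=> [|x y /= Ex /(El x)|x /= /(Er x^-1)|x g /= /(El g^-1) /(Er g)] /=.
  - exact: Erefl.
  - by rewrite mulg1; exact: Etrans.
  - by rewrite mul1g mulgV => /Esym.
  - by rewrite mulg1 mulVg /conjg mulgA.
(* By left invariance, [E x y] holds exactly when [x^-1 * y] lies in the class of 1. *)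
case: (sG _ nN) => NE; [left|right]; apply/funext => x; apply/funext => y;
    apply/propext; split=> [Exy|xy] //.
- have : [set u | E 1 u] (x^-1 * y) by have := El x^-1 _ _ Exy; rewrite mulVg.
  by rewrite NE => /= /(congr1 (fun t => x * t)); rewrite mulgA mulgV mul1g mulg1.
- by rewrite xy.
- have : [set u | E 1 u] (x^-1 * y) by rewrite NE.
  by move=> /(El x); rewrite mulg1 mulgA mulgV mul1g.
Qed.

Lemma rtrans_stab_trivial :
  simple_group G -> rtrans_stab = [set 1] ->
  E = (fun x y => x = y) \/ E = (fun _ _ => True).
Proof.
move=> [_ sG] T1.
have T1P c : rtrans_stab c -> c = 1 by rewrite T1.
have comm x y : x * y = y * x.
  (* The commutator arises by reversing the trivial product of [y], [x] and [(y * x)^-1]. *)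
  have /T1P : rtrans_stab ((y * x)^-1 * x * y).
    by apply: rtrans_stab_rev; rewrite mulgV.
  by move/(congr1 (fun t => y * x * t)) => /=; rewrite mulg1 !mulgA mulgV mul1g.
have sqr z : z * z = 1.
  apply: T1P => x y; rewrite (two_sided_iff z).
  by rewrite (comm z x) (comm z y) !mulgA.
have invz z : z^-1 = z by apply: (mulgI z); rewrite mulgV sqr.
(* [G] is now abelian of exponent 2. *)
have nN (w : G) : normal_subgroup [set x | x = 1 \/ x = w].
  split=> [|x y /= [] -> [] ->|x|x g] /=; rewrite ?mul1g ?mulg1 ?sqr; auto.
  - by rewrite invz.
  - by rewrite /conjg (comm x) mulKg.
case: (pselect (exists x y, E x y /\ x <> y)) => [[a [b [Eab ab]]]|noE]; last first.
  left; apply/funext => x; apply/funext => y; apply/propext.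
  split=> [Exy|-> //]; apply: contrapT => xy; apply: noE; by exists x, y.
right; suff Ea u : E a u.
  by apply/funext => x; apply/funext => y; apply/propext; split=> // _;
    apply: Etrans (Ea y); apply: Esym.
(* Since [a] and [b] differ, 1 and [b * a^-1] make up all of [G], so every [u] is [a] or [b]. *)
case: (sG _ (nN (b * a^-1))) => NE.
- have : [set 1] (b * a^-1) by rewrite -NE; right.
  by move/(congr1 (fun t => t * a)); rewrite mulgVK mul1g => /esym.
- have : [set x | x = 1 \/ x = b * a^-1] (u * a^-1) by rewrite NE.
  by case=> /(congr1 (fun t => t * a)); rewrite !mulgVK ?mul1g => ->.
Qed.

End Invariant.

Lemma simple_group_primitive_core : simple_group G -> primitive_quandle (core G).
Proof.
move=> sG; have [[x x1] sN] := sG; split; first by exists x, 1.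
move=> E eqvE HE.
have invE (z a b : G) : E a b -> E (z * a * z) (z * b * z).
  (* Translation by 1 is inversion; following it by translation by [z] removes the inverse. *)
  move=> /(HE _ (qop_LMlt (1 : core G))) /(HE _ (qop_LMlt (z : core G))).
  by rewrite !qop_coreE !mulg1 !mul1g !invgK.
case: (sN _ (rtrans_stab_normal invE)) => TE.
- exact: rtrans_stab_trivial TE.
- exact: rtrans_stab_full TE.
Qed.

End Core.

Theorem theorem2p4 (G : groupType) :
  [<-> primitive_quandle (core G);
       simple_quandle (core G);
       simple_group G].
Proof.
tfae.
- exact: primitive_simple_quandle.
- exact: simple_quandle_core_group.
- exact: simple_group_primitive_core.
Qed.
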